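(* Every semigroup with apartness $S$ se-embeds into the semigroup $\mathcal{T}_X^{se}$ of all strongly extensional self-maps of some set with apartness $X$; that is, there is an injective homomorphism $\varphi:S\to\mathcal{T}_X^{se}$ which is strongly extensional.
   Context: Constructive (Bishop-style) setting. A set with apartness $(X,=,\#)$: inhabited set with equality $=$ (an equivalence) and $\#$ with $\neg(x\#x)$, $x\#y\Rightarrow y\#x$, $x\#z\Rightarrow\forall y(x\#y\vee y\#z)$, extensional w.r.t. $=$. A mapping is strongly extensional (se) if $f(x)\#f(y)\Rightarrow x\#y$. A semigroup with apartness is a set with apartness with an associative operation satisfying $ax\#by\Rightarrow(a\#b\vee x\#y)$. $\mathcal{T}_X^{se}$ is the set of se-mappings $X\to X$ under composition, with $f=g\iff\forall x(f(x)=g(x))$ and $f\#g\iff\exists x(f(x)\#g(x))$; it is a semigroup with apartness. An se-embedding is a homomorphism that is injective and strongly extensional. *)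

(* Defs.v *)
(* No axioms are used.  Following Bishop, a set is a type
   together with its own equality relation [==]; Leibniz equality plays no
   role.  Hence every mapping and operation is required to respect [==]. *)
From Stdlib Require Export Relations RelationClasses Morphisms Setoid.

Set Implicit Arguments.
Unset Strict Implicit.

Declare Scope apart_scope.
Delimit Scope apart_scope with apart.
Open Scope apart_scope.

(* The apartness is not assumed tight: [~ x # y] need not give [x == y]. *)
Record apart_set : Type := ApartSet {
  carrier :> Type;
  eqv : relation carrier;
  apart : relation carrier;
  apart_set_inhabited : inhabited carrier;
  eqv_equiv : Equivalence eqv;
  apart_irrefl : forall x, ~ apart x x;
  apart_sym : forall x y, apart x y -> apart y x;
  apart_cotrans : forall x z, apart x z -> forall y, apart x y \/ apart y z;
  apart_ext : forall x x' y y',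
    eqv x x' -> eqv y y' -> apart x y -> apart x' y'
}.

Arguments eqv {_} _ _.
Arguments apart {_} _ _.

Notation "x == y" := (eqv x y) (at level 70, no associativity) : apart_scope.
Notation "x # y" := (apart x y) (at level 70, no associativity) : apart_scope.

#[export] Existing Instance eqv_equiv.

Definition extensional (X Y : apart_set) (f : X -> Y) : Prop :=
  forall x y, x == y -> f x == f y.

Definition strongly_extensional (X Y : apart_set) (f : X -> Y) : Prop :=
  forall x y, f x # f y -> x # y.

Definition injective (X Y : apart_set) (f : X -> Y) : Prop :=
  forall x y, f x == f y -> x == y.

Record apart_semigroup : Type := ApartSemigroup {
  sg_set :> apart_set;
  mul : sg_set -> sg_set -> sg_set;
  mul_ext : forall a a' x x', a == a' -> x == x' -> mul a x == mul a' x';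
  mul_assoc : forall a b c, mul (mul a b) c == mul a (mul b c);
  mul_se : forall a b x y, mul a x # mul b y -> a # b \/ x # y
}.

Arguments mul {_} _ _.

Notation "x * y" := (mul x y) : apart_scope.

Definition homomorphism (S T : apart_semigroup) (f : S -> T) : Prop :=
  forall x y, f (x * y) == f x * f y.

(* [extensional] makes [f] a mapping; as the apartness need not be tight, it
   does not follow from strong extensionality. *)
Definition se_embedding (S T : apart_semigroup) (f : S -> T) : Prop :=
  extensional f /\ homomorphism f /\ injective f /\ strongly_extensional f.

Record se_map (X : apart_set) : Type := SeMap {
  se_fun :> X -> X;
  se_fun_ext : extensional se_fun;
  se_fun_se : strongly_extensional se_fun
}.

Section SeTransformations.
Variable X : apart_set.

Definition se_eqv (f g : se_map X) : Prop := forall x, f x == g x.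

Definition se_apart (f g : se_map X) : Prop := exists x, f x # g x.

Definition se_id : se_map X :=
  @SeMap X (fun x => x) (fun _ _ h => h) (fun _ _ h => h).

Definition se_comp (f g : se_map X) : se_map X :=
  @SeMap X (fun x => f (g x))
    (fun _ _ h => @se_fun_ext X f _ _ (@se_fun_ext X g _ _ h))
    (fun _ _ h => @se_fun_se X g _ _ (@se_fun_se X f _ _ h)).

Lemma se_eqv_equiv : Equivalence se_eqv.
Proof.
  split.
  - intros f x; reflexivity.
  - intros f g h x; symmetry; apply h.
  - intros f g k h1 h2 x; transitivity (g x); auto.
Qed.

Lemma se_apart_irrefl (f : se_map X) : ~ se_apart f f.
Proof. intros [x h]; exact (apart_irrefl h). Qed.

Lemma se_apart_sym (f g : se_map X) : se_apart f g -> se_apart g f.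
Proof. intros [x h]; exists x; apply apart_sym, h. Qed.

Lemma se_apart_cotrans (f k : se_map X) :
  se_apart f k -> forall g, se_apart f g \/ se_apart g k.
Proof.
  intros [x h] g.
  destruct (apart_cotrans h (g x)) as [h1|h1]; [left|right]; exists x; exact h1.
Qed.

Lemma se_apart_ext (f f' g g' : se_map X) :
  se_eqv f f' -> se_eqv g g' -> se_apart f g -> se_apart f' g'.
Proof.
  intros hf hg [x h]; exists x; exact (apart_ext (hf x) (hg x) h).
Qed.

Definition se_map_set : apart_set :=
  @ApartSet (se_map X) se_eqv se_apart (inhabits se_id) se_eqv_equiv
    se_apart_irrefl se_apart_sym se_apart_cotrans se_apart_ext.

Lemma se_comp_ext (f f' g g' : se_map_set) :
  f == f' -> g == g' -> (se_comp f g : se_map_set) == se_comp f' g'.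
Proof.
  intros hf hg x; simpl.
  transitivity (f (g' x)); [exact (@se_fun_ext X f _ _ (hg x)) | exact (hf (g' x))].
Qed.

Lemma se_comp_assoc (f g h : se_map_set) :
  (se_comp (se_comp f g) h : se_map_set) == se_comp f (se_comp g h).
Proof. intros x; simpl; reflexivity. Qed.

Lemma se_comp_se (f f' g g' : se_map_set) :
  (se_comp f g : se_map_set) # se_comp f' g' -> f # f' \/ g # g'.
Proof.
  intros [x h]; simpl in h.
  destruct (apart_cotrans h (f (g' x))) as [h1|h1].
  - right; exists x; exact (@se_fun_se X f _ _ h1).
  - left; exists (g' x); exact h1.
Qed.

Definition T_se : apart_semigroup :=
  @ApartSemigroup se_map_set se_comp se_comp_ext se_comp_assoc se_comp_se.

End SeTransformations.

(* Main.v *)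
(* Cayley's argument: S acts by left translations on S with an external unit
   adjoined.  The unit is declared apart from every element of S, so that the
   translations remain strongly extensional; evaluating at the unit recovers
   the translating element, which makes the action faithful. *)
Require Import Defs.

Section AdjoinPoint.
Variable X : apart_set.

Definition point_eqv (u v : option X) : Prop :=
  match u, v with
  | Some x, Some y => x == y
  | None, None => True
  | _, _ => False
  end.

Definition point_apart (u v : option X) : Prop :=
  match u, v with
  | Some x, Some y => x # y
  | None, None => False
  | _, _ => True
  end.

Lemma point_eqv_equiv : Equivalence point_eqv.
Proof.
  split.
  - intros [x|]; simpl; [reflexivity | exact I].
  - intros [x|] [y|]; simpl; auto; intros h; symmetry; exact h.
  - intros [x|] [y|] [z|]; simpl; try tauto.
    intros h1 h2; transitivity y; assumption.
Qed.

Lemma point_apart_irrefl (u : option X) : ~ point_apart u u.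
Proof. destruct u as [x|]; simpl; [apply apart_irrefl | tauto]. Qed.

Lemma point_apart_sym (u v : option X) : point_apart u v -> point_apart v u.
Proof. destruct u, v; simpl; auto; apply apart_sym. Qed.

(** Whether a point is [None] is decidable, so case analysis settles every triple in which [None]
    occurs; the others inherit cotransitivity from [X]. *)
Lemma point_apart_cotrans (u w : option X) :
  point_apart u w -> forall v, point_apart u v \/ point_apart v w.
Proof.
  destruct u as [x|], w as [z|]; intros h [y|]; simpl in *; try tauto.
  exact (apart_cotrans h y).
Qed.

Lemma point_apart_ext (u u' v v' : option X) :
  point_eqv u u' -> point_eqv v v' -> point_apart u v -> point_apart u' v'.
Proof.
  destruct u, u', v, v'; simpl; try tauto; apply apart_ext.
Qed.

Definition adjoin_point : apart_set :=
  @ApartSet (option X) point_eqv point_apart (inhabits None) point_eqv_equiv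
    point_apart_irrefl point_apart_sym point_apart_cotrans point_apart_ext.

End AdjoinPoint.

Section LeftTranslation.
Variable S : apart_semigroup.

(** [None] stands for the unit, whose product with [a] is [a] itself. *)
Definition translate (a : S) (u : adjoin_point S) : adjoin_point S :=
  match u with
  | Some x => Some (a * x)
  | None => Some a
  end.

Lemma translate_ext (a : S) : extensional (translate a).
Proof.
  intros [x|] [y|]; simpl; try tauto.
  - intros h; apply mul_ext; [reflexivity | exact h].
  - intros _; reflexivity.
Qed.

(** From [a * x # a * y] follows [a # a], which is absurd, or [x # y]. For a mixed pair the
    conclusion holds outright, the unit being apart from all of [S]. *)
Lemma translate_se (a : S) : strongly_extensional (translate a).
Proof.
  intros [x|] [y|]; simpl; try tauto.
  - intros h; destruct (mul_se h) as [h1|h1]; [|exact h1].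
    destruct (apart_irrefl h1).
  - apply apart_irrefl.
Qed.

Definition left_translation (a : S) : T_se (adjoin_point S) :=
  SeMap (@translate_ext a) (@translate_se a).

Lemma left_translation_embedding : se_embedding left_translation.
Proof.
  repeat split.
  - intros a b h [x|]; simpl; [|exact h].
    apply mul_ext; [exact h | reflexivity].
  (* At the unit both sides compute to [a * b]. *)
  - intros a b [x|]; simpl; [apply mul_assoc | reflexivity].
  - intros a b h; exact (h None).
  (* A witness of apartness at [None] is already [a # b]; at [Some x] the alternative [x # x] is
     excluded. *)
  - intros a b [[x|] h]; simpl in h; [|exact h].
    destruct (mul_se h) as [h1|h1]; [exact h1|].
    destruct (apart_irrefl h1).
Qed.

End LeftTranslation.

Theorem theorem20 (S : apart_semigroup) :
  exists (X : apart_set) (phi : S -> T_se X), se_embedding phi.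
Proof.
  exists (adjoin_point S), (@left_translation S).
  apply left_translation_embedding.
Qed.
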